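(* Let $\mathfrak F$ be a subgroup-closed saturated formation such that $\mathfrak U\subseteq \mathfrak F\subseteq \mathcal{D}$. Let $G$ be a finite group, and let $G = G_1G_2$ be the product of msp-permutable subgroups $G_1$ and $G_2$. If $G_1, G_2\in \mathfrak F$, then $G\in \mathfrak F$.
   Context: All groups are finite. Two subgroups $X$ and $Y$ of a group are called mutually permutable if $UY=YU$ and $XV=VX$ for all subgroups $U\le X$ and $V\le Y$. Subgroups $A$ and $B$ of a group $G$ are called msp-permutable if: (i) $AB$ is a subgroup of $G$; (ii) whenever $p\neq q$ are primes, $P$ is an arbitrary Sylow $p$-subgroup of $A$ and $Q$ is an arbitrary Sylow $q$-subgroup of $B$, the subgroups $P$ and $Q$ are mutually permutable. A formation is a class $\mathfrak F$ of (finite) groups, closed under isomorphism, such that quotients of groups in $\mathfrak F$ belong to $\mathfrak F$, and such that $G/N_1\in\mathfrak F$ and $G/N_2\in\mathfrak F$ imply $G/(N_1\cap N_2)\in\mathfrak F$ for normal subgroups $N_1,N_2$ of $G$. A formation $\mathfrak F$ is saturated if $G/\Phi(G)\in\mathfrak F$ implies $G\in\mathfrak F$, where $\Phi(G)$ is the Frattini subgroup; it is subgroup-closed if every subgroup of a group in $\mathfrak F$ belongs to $\mathfrak F$. $\mathfrak U$ is the class of all supersoluble groups (groups all of whose chief factors have prime order). $\mathcal D$ is the class of all groups having an ordered Sylow tower of supersoluble type: a group $G$ with $|G|=p_1^{a_1}\cdots p_k^{a_k}$, $p_1>p_2>\ldots>p_k$ primes, belongs to $\mathcal D$ if for each $i=1,\ldots,k$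 it has a normal subgroup of order $p_1^{a_1}\cdots p_i^{a_i}$. *)

(* Defs.v *)
From mathcomp Require Import all_boot all_fingroup all_solvable.

Set Implicit Arguments.
Unset Strict Implicit.
Unset Printing Implicit Defensive.

Local Open Scope group_scope.

Definition mutually_permutable (gT : finGroupType) (X Y : {group gT}) : Prop :=
  (forall U : {group gT}, U \subset X -> U * Y = Y * U) /\
  (forall V : {group gT}, V \subset Y -> X * V = V * X).

Definition msp_permutable (gT : finGroupType) (A B : {group gT}) : Prop :=
  group_set (A * B) /\
  forall (p q : nat) (P Q : {group gT}),
    prime p -> prime q -> p != q ->
    p.-Sylow(A) P -> q.-Sylow(B) Q -> mutually_permutable P Q.

(* A group is a subgroup of some ambient finGroupType, so a class of groups is
   a predicate on all such subgroups; invariance under isomorphism (between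
   possibly different ambient types) is part of [formation]. *)
Definition group_class := forall gT : finGroupType, {group gT} -> Prop.

Definition class_sub (E F : group_class) : Prop :=
  forall (gT : finGroupType) (G : {group gT}), E gT G -> F gT G.

Definition isog_closed (F : group_class) : Prop :=
  forall (gT rT : finGroupType) (G : {group gT}) (H : {group rT}),
    G \isog H -> F gT G -> F rT H.

Definition quotient_closed (F : group_class) : Prop :=
  forall (gT : finGroupType) (G N : {group gT}),
    N <| G -> F gT G -> F (coset_of N) (G / N)%G.

Definition residually_closed (F : group_class) : Prop :=
  forall (gT : finGroupType) (G N1 N2 : {group gT}),
    N1 <| G -> N2 <| G ->
    F (coset_of N1) (G / N1)%G -> F (coset_of N2) (G / N2)%G ->
    F (coset_of (N1 :&: N2)) (G / (N1 :&: N2))%G.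

Definition formation (F : group_class) : Prop :=
  [/\ isog_closed F, quotient_closed F & residually_closed F].

Definition saturated (F : group_class) : Prop :=
  forall (gT : finGroupType) (G : {group gT}),
    F (coset_of 'Phi(G)) (G / 'Phi(G))%G -> F gT G.

Definition subgroup_closed (F : group_class) : Prop :=
  forall (gT : finGroupType) (G H : {group gT}),
    H \subset G -> F gT G -> F gT H.

(* In [chief_factor G V U] the section is U / V. *)
Definition supersoluble : group_class := fun gT G =>
  forall V U : {group gT}, chief_factor G V U -> prime #|U / V|.

(* [primes n] is increasing, so [rev (primes #|G|)] is p_1 > ... > p_k. *)
Definition sylow_tower_supersoluble_type : group_class := fun gT G =>
  let ps := rev (primes #|G|) in
  forall i : nat, 0 < i <= size ps ->
  exists2 N : {group gT},
    N <| G & #|N| = (\prod_(p <- take i ps) p ^ logn p #|G|)%N.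

(* Main.v *)
Require Import Defs.
From HB Require Import structures.
From mathcomp Require Import all_boot all_fingroup all_solvable.

(** Argue by induction on the order of [G = G1 G2], writing [A] and [B] for
    the factors.

    Let [p] be the largest prime divisor of the order of [G].  If [q < p] and
    a [p]-group [P] and a [q]-group [Q] are mutually permutable, then [Q]
    normalises every subgroup of [P]: for [P] itself, count the conjugates of
    [P] in [P Q]; subgroups of [P] are permutable with those of [Q] too
    ([mutually_permutable_norm]).  Since [A] and [B] have Sylow towers, their
    Sylow [p]-subgroups [P] and [Q] are normal in them, the product [S = P Q]
    is a Sylow [p]-subgroup of [G], and it is normal in [G].

    Proper quotients of [G] inherit the hypotheses, so they lie in [F].  As [F]
    is a saturated formation, one may assume that [G] has trivial Frattini
    subgroup and that two nontrivial normal subgroups always meet.  Then [S] is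
    a self-centralising minimal normal subgroup with a complement.  Since [P]
    and [Q] are normal in [G], one of them is [S]; say [P = S].  Then [B] acts
    on the elementary abelian group [S] by power automorphisms, i.e., by
    scalars: [G] is obtained from [A], in [F], by adjoining scalars to its
    action on [S] ([formation_power_factor]).

    What remains is that adjoining scalars preserves [F].  It is a consequence
    of the theorem that saturated formations are local, but there is a direct
    construction ([formation_power_twist]).  Write [A] as [S M], let [D] be a
    group of scalars on [S] commuting with [M], and let [X] be a subgroup of
    order [p] of [S], so that [X D] is supersoluble.  Consider the
    block-triangular matrices
<<
      [ d  l  w ]
      [ 0  1  v ]      d in D, l in X = F_p, v and w in S, m in M.
      [ 0  0  m ]
>>
    The two diagonal blocks that share the entry [1] are copies of [X D] and
    [A], so both lie in [F]; the kernel of the projection to the pair of them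
    consists of the matrices whose only nontrivial entry is [w], and these are
    commutators of elements of a normal [p]-subgroup, hence lie in the Frattini
    subgroup.  So the matrix group lies in [F] ([saturated_subdirect]), and so
    does the subgroup [l = 0, v = 0], where [d] and [m] both act on [w].  This
    subgroup maps onto [S M D = G]. *)

Set Implicit Arguments.
Unset Strict Implicit.
Unset Printing Implicit Defensive.

Local Open Scope group_scope.

(** * Frattini subgroups and supersolubility *)

Lemma mulg_normal_not_sub_maximal (gT : finGroupType) (G N M : {group gT}) :
  N <| G -> maximal M G -> ~~ (N \subset M) -> N * M = G.
Proof.
case/andP=> sNG nNG /maxgroupP[/andP[sMG _] maxM] not_sNM.
rewrite -norm_joinEr ?(subset_trans sMG) //; apply/eqP; rewrite eqEproper.
rewrite join_subG sNG sMG; apply: contra not_sNM => ltG.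
by rewrite -(maxM _ ltG) ?joing_subl ?joing_subr.
Qed.

Lemma not_sub_Phi_maximal (gT : finGroupType) (G N : {group gT}) :
    N \subset G -> ~~ (N \subset 'Phi(G)) ->
  exists2 M : {group gT}, maximal M G & ~~ (N \subset M).
Proof.
move=> sNG not_sNPhi; apply/exists_inP; apply: contraR not_sNPhi.
rewrite negb_exists_in => /forall_inP sNmax.
apply/bigcapsP=> M /predU1P[-> // | maxM].
by have := sNmax M maxM; rewrite negbK.
Qed.

(** If a maximal subgroup [M] of [G] does not contain ['Phi(N)], then
    [G = 'Phi(N) M], so [N = 'Phi(N) (M :&: N)] and [M] contains [N] because
    elements of ['Phi(N)] are non-generators of [N]. *)
Lemma Phi_normalS (gT : finGroupType) (G N : {group gT}) :
  N <| G -> 'Phi(N) \subset 'Phi(G).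
Proof.
case/andP=> sNG nNG; apply/bigcapsP=> M /predU1P[-> | maxM].
  by rewrite (subset_trans (Phi_sub N)).
have [sMG _] := andP (maxgroupp maxM).
have nPhiG : G \subset 'N('Phi(N)) := gFnorm_trans _ nNG.
apply: contraT => not_sPhiM; case/negP: (not_sPhiM).
have nsPhiG : 'Phi(N) <| G.
  by rewrite /normal nPhiG (subset_trans (Phi_sub N)).
have defG := mulg_normal_not_sub_maximal nsPhiG maxM not_sPhiM.
have defN : 'Phi(N) <*> (M :&: N) = N.
  rewrite norm_joinEr; last by rewrite subIset // (subset_trans sMG nPhiG).
  by rewrite group_modl ?Phi_sub // defG; apply/setIidPr.
have/Phi_nongen := defN; rewrite genGid => <-.
by apply: subset_trans (Phi_sub _) _; rewrite subIset ?subxx.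
Qed.

(** For a chief factor [U / V], either some element of [U :&: P] is outside [V],
    and it spans a normal subgroup, or [V] contains [U :&: P]; then [U / V] is
    central, because [[~: G, U]] lies in [P :&: U].  Either way [U / V] contains
    a normal subgroup of prime order. *)
Lemma supersoluble_power_action (gT : finGroupType) (p : nat)
    (G P : {group gT}) :
    p.-abelem P -> P <| G -> (forall x, x \in P -> <[x]> <| G) ->
    abelian (G / P) ->
  supersoluble G.
Proof.
move=> abelP nsPG nsxG abGP V U chiefUV.
have minUV := chief_factor_minnormal chiefUV.
have{chiefUV} [/maxgroupP[/andP[/andP[sVU not_sUV] nVG] _] nsUG] :=
  andP chiefUV.
have [/andP[ntU _] minU] := mingroupP minUV.
have nVU : U \subset 'N(V) := subset_trans (normal_sub nsUG) nVG.
suff [y [Uy pr_y nsyG]] :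
    exists y, [/\ y \in U / V, prime #[y] & <[y]> <| G / V].
  have [_ nyG] := andP nsyG; rewrite -(minU <[y]>%G) ?cycle_subG //=.
  by rewrite -cardG_gt1 prime_gt1.
have [sUPV | not_sUPV] := boolP (U :&: P \subset V).
  have [|y Uy oy] := Cauchy (pdiv_prime _) (pdiv_dvd #|U / V|).
    by rewrite cardG_gt1.
  (* Since [U / V] is central, the subgroup spanned by any of its elements is
     normal in [G / V]. *)
  exists y; split=> //; first by rewrite oy pdiv_prime // cardG_gt1.
  rewrite /normal cycle_subG (subsetP (quotientS V (normal_sub nsUG))) //=.
  apply: cents_norm; rewrite cent_cycle sub_cent1.
  have : U / V \subset 'C(G / V); last by move/subsetP; apply.
  rewrite quotient_cents2 // (subset_trans _ sUPV) // subsetI commg_subl.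
  rewrite normal_norm //= (subset_trans (commSg _ (normal_sub nsUG))) //.
  by rewrite -derg1 der1_min // normal_norm.
have [x /setIP[Ux Px] notVx] := subsetPn not_sUPV.
have Nx : x \in 'N(V) := subsetP nVU x Ux.
have ntx : coset V x != 1 by apply: contra notVx => /eqP/coset_idr->.
exists (coset V x); split; first exact: mem_quotient.
  rewrite (abelem_order_p (quotient_abelem V abelP)) ?mem_quotient //.
  have [||p_pr _ _ //] := @pgroup_pdiv _ p P; first exact: abelem_pgroup abelP.
  by apply: contra notVx => /eqP P1; move: Px; rewrite P1 => /set1P->.
by rewrite -quotient_cycle // quotient_normal // nsxG.
Qed.

(** * Saturated formations *)

Section Formations.

Variable F : group_class.
Hypotheses (Fformation : formation F) (Fsaturated : saturated F).

Lemma formation_morphim (gT rT : finGroupType) (G : {group gT})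
    (f : {morphism G >-> rT}) :
  F G -> F (f @* G)%G.
Proof.
have [Fisog Fquo _] := Fformation.
by move/(Fquo _ _ _ (ker_normal f)); apply: Fisog (first_isog f).
Qed.

Lemma formation_Phi (gT : finGroupType) (G N : {group gT}) :
  N <| G -> N \subset 'Phi(G) -> F (G / N)%G -> F G.
Proof.
have [Fisog Fquo _] := Fformation.
move=> nsNG sNPhi FGN; apply: Fsaturated.
apply: Fisog (third_isog sNPhi nsNG (Phi_normal G)) _.
have nsPhiN := quotient_normal N (Phi_normal G).
exact: (Fquo _ (G / N)%G ('Phi(G) / N)%G nsPhiN FGN).
Qed.

(** Modulo the intersection of the two kernels, [G] is a subdirect product of
    the images, hence in [F]; saturation then lifts this to [G]. *)
Lemma saturated_subdirect (gT rT1 rT2 : finGroupType) (G : {group gT})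
    (f1 : {morphism G >-> rT1}) (f2 : {morphism G >-> rT2}) :
    'ker f1 :&: 'ker f2 \subset 'Phi(G) ->
  F (f1 @* G)%G -> F (f2 @* G)%G -> F G.
Proof.
have [Fisog _ Fres] := Fformation; move=> sKPhi Ff1 Ff2.
apply: (@formation_Phi _ _ ('ker f1 :&: 'ker f2)%G) => //.
  by rewrite normalI ?ker_normal.
apply: (Fres _ G ('ker f1)%G ('ker f2)%G); rewrite ?ker_normal //.
  by apply: Fisog Ff1; rewrite isog_sym first_isog.
by apply: Fisog Ff2; rewrite isog_sym first_isog.
Qed.

Lemma formation_trivial_meet (gT : finGroupType) (G N1 N2 : {group gT}) :
    N1 <| G -> N2 <| G -> N1 :&: N2 = 1 ->
  F (G / N1)%G -> F (G / N2)%G -> F G.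
Proof.
have [Fisog _ Fres] := Fformation => nsN1 nsN2 tiN FN1 FN2.
have := Fres _ _ _ _ nsN1 nsN2 FN1 FN2; apply: Fisog.
by rewrite /= tiN isog_sym quotient1_isog.
Qed.

End Formations.

(** * The extension defined by a pairing *)

(** The data needed to multiply triples [(r, a, w)] like the block-triangular
    matrices described above: [r] acts on [P] on the left, by conjugation by its
    inverse, [a] acts on the right, and [pairing_fun r a] stands for the product
    [l v] of the off-diagonal entries of the blocks [r] and [a].  The two
    multiplicativity laws say that it is a crossed homomorphism in each
    argument; together they make the product of triples associative. *)
Record pairing (gT : finGroupType) (R A P : {group gT}) := Pairing {
  pairing_fun :> gT -> gT -> gT;
  pairing_cPP : abelian P;
  pairing_nPR : R \subset 'N(P);
  pairing_nPA : A \subset 'N(P);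
  pairing_actC : forall r a w, r \in R -> a \in A -> w \in P ->
    (w ^ r) ^ a = (w ^ a) ^ r;
  pairing_closed : forall r a, r \in R -> a \in A -> pairing_fun r a \in P;
  pairingMl : forall r s a, r \in R -> s \in R -> a \in A ->
    pairing_fun (r * s) a = pairing_fun r a * pairing_fun s a ^ r^-1;
  pairingMr : forall r a b, r \in R -> a \in A -> b \in A ->
    pairing_fun r (a * b) = pairing_fun r a ^ b * pairing_fun r b
}.

Section PairingExtension.

Variables (gT : finGroupType) (R A P : {group gT}).

Inductive pairing_ext (beta : pairing R A P) : predArgType :=
  PairingExt (u : gT * gT * gT) of u \in setX (setX R A) P.

Coercion triple_of_pairing_ext beta (u : pairing_ext beta) :=
  let: PairingExt x _ := u in x.

Variable beta : pairing R A P.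

Notation E := (pairing_ext beta).
Notation Eval := (@triple_of_pairing_ext beta).

HB.instance Definition _ := [isSub for Eval].
#[hnf] HB.instance Definition _ := [Finite of E by <:].

Lemma pairing_extP (u : E) : [/\ u.1.1 \in R, u.1.2 \in A & u.2 \in P].
Proof. by case: u => [[[r a] w]] /=; rewrite !inE /= => /andP[/andP[]]. Qed.

Lemma pairing1l a : a \in A -> beta 1 a = 1.
Proof.
move=> Aa; apply: (mulgI (beta 1 a)).
by rewrite mulg1 -{3}(mulg1 1) pairingMl // invg1 conjg1.
Qed.

Lemma pairing1r r : r \in R -> beta r 1 = 1.
Proof.
move=> Rr; apply: (mulgI (beta r 1)).
by rewrite mulg1 -{3}(mulg1 1) pairingMr // conjg1.
Qed.

Let memJR r w : r \in R -> w \in P -> w ^ r \in P.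
Proof. by move=> Rr Pw; rewrite memJ_norm // (subsetP (pairing_nPR beta)). Qed.

Let memJA a w : a \in A -> w \in P -> w ^ a \in P.
Proof. by move=> Aa Pw; rewrite memJ_norm // (subsetP (pairing_nPA beta)). Qed.

Definition pairing_ext_one : E := PairingExt beta (group1 _).

Lemma pairing_ext_mul_proof (u v : E) :
  (u.1.1 * v.1.1, u.1.2 * v.1.2,
    beta u.1.1 v.1.2 * u.2 ^ v.1.2 * v.2 ^ u.1.1^-1)
    \in setX (setX R A) P.
Proof.
have [[Rr Aa Pw] [Rs Ab Pz]] := (pairing_extP u, pairing_extP v).
rewrite !inE /= (groupM Rr Rs) (groupM Aa Ab) /=.
by rewrite groupM ?memJR ?groupV // groupM ?memJA ?pairing_closed.
Qed.

Definition pairing_ext_mul u v := PairingExt beta (pairing_ext_mul_proof u v).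

Lemma pairing_ext_inv_proof (u : E) :
  (u.1.1^-1, u.1.2^-1, (u.2 ^ u.1.1 * beta u.1.1^-1 u.1.2)^-1 ^ u.1.2^-1)
    \in setX (setX R A) P.
Proof.
have [Rr Aa Pw] := pairing_extP u; rewrite !inE /= !groupV Rr Aa.
by rewrite memJA ?groupV // groupM ?memJR ?pairing_closed ?groupV.
Qed.

Definition pairing_ext_inv u := PairingExt beta (pairing_ext_inv_proof u).

Lemma pairing_ext_mul1g : left_id pairing_ext_one pairing_ext_mul.
Proof.
move=> u; apply: val_inj; have [Rr Aa Pw] := pairing_extP u.
case: u Rr Aa Pw => [[[r a] w]] /= _ Rr Aa Pw.
by rewrite pairing1l // conj1g invg1 conjg1 !mul1g.
Qed.

Lemma pairing_ext_mulVg : left_inverse pairing_ext_one pairing_ext_inv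
  pairing_ext_mul.
Proof.
move=> u; apply: val_inj; have [Rr Aa Pw] := pairing_extP u.
case: u Rr Aa Pw => [[[r a] w]] /= _ Rr Aa Pw.
by rewrite !mulVg conjgKV invMg invgK mulKVg mulVg.
Qed.

Lemma pairing_ext_mulA : associative pairing_ext_mul.
Proof.
move=> u v t; apply: val_inj.
have [[Rr Aa Pw] [Rs Ab Pz]] := (pairing_extP u, pairing_extP v).
have [Rk Ac Py] := pairing_extP t.
case: u v t Rr Aa Pw Rs Ab Pz Rk Ac Py => [[[r a] w] hu] [[[s b] z] hv].
case=> [[[k c] y] ht] /= Rr Aa Pw Rs Ab Pz Rk Ac Py.
have CP := centsP (pairing_cPP beta).
congr (_, _, _); [exact: mulgA | exact: mulgA |].
rewrite pairingMr // pairingMl //.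
rewrite (conjMg (_ * _) _ c) (conjMg (beta r b) _ c) -(conjgM w b c).
rewrite (conjMg (_ * _) _ r^-1) (conjMg (beta s c) _ r^-1) -(conjgM y) -invMg.
rewrite (@pairing_actC _ _ _ _ beta r^-1 c z) ?groupV //.
have : beta r b ^ c \in P by rewrite memJA ?pairing_closed.
have : beta r c \in P by rewrite pairing_closed.
have : beta s c ^ r^-1 \in P by rewrite memJR ?groupV ?pairing_closed.
have : w ^ (b * c) \in P by rewrite memJA ?groupM.
move: (beta r b ^ c) (beta r c) (beta s c ^ r^-1) (w ^ _) ((z ^ c) ^ _) (y ^ _).
move=> x1 x2 x3 x4 x5 x6 Px4 Px3 Px2 Px1; rewrite !mulgA.
do 2!congr (_ * _).
by rewrite -(mulgA _ x4) (CP x4 Px4 x3 Px3) mulgA -(mulgA x1) (CP x1) ?groupM.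
Qed.

HB.instance Definition _ := Finite_isGroup.Build E
  pairing_ext_mulA pairing_ext_mul1g pairing_ext_mulVg.

Definition pairing_group : {group E} := [set: E]%G.

Definition pairing_left (u : E) := u.1.1.
Definition pairing_right (u : E) := u.1.2.

Lemma pairing_leftM :
  {in pairing_group &, {morph pairing_left : u v / u * v}}.
Proof. by []. Qed.

Lemma pairing_rightM :
  {in pairing_group &, {morph pairing_right : u v / u * v}}.
Proof. by []. Qed.

Canonical pairing_left_morphism := Morphism pairing_leftM.
Canonical pairing_right_morphism := Morphism pairing_rightM.

Lemma pairing_ext_exists r a w : r \in R -> a \in A -> w \in P ->
  exists u : E, Eval u = (r, a, w).
Proof.
move=> Rr Aa Pw; have triple_in : (r, a, w) \in setX (setX R A) P.
  by rewrite !inE /= Rr Aa.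
by exists (PairingExt beta triple_in).
Qed.

Lemma morphim_pairing_left : pairing_left @* pairing_group = R.
Proof.
apply/setP=> r; apply/morphimP/idP=> [[u _ _ ->] | Rr].
  by case: (pairing_extP u).
have [u Du] := pairing_ext_exists Rr (group1 A) (group1 P).
by exists u; rewrite ?inE //= /pairing_left Du.
Qed.

Lemma morphim_pairing_right : pairing_right @* pairing_group = A.
Proof.
apply/setP=> a; apply/morphimP/idP=> [[u _ _ ->] | Aa].
  by case: (pairing_extP u).
have [u Du] := pairing_ext_exists (group1 R) Aa (group1 P).
by exists u; rewrite ?inE //= /pairing_right Du.
Qed.

(** If the pairing maps [X] times [Y] onto [P], then every triple [(1, 1, w)] is
    a commutator of some [(x, 1, 1)] and [(1, y, 1)].  These lie in a normal
    [p]-subgroup, whose derived subgroup is inside its Frattini subgroup. *)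
Lemma pairing_ext_Phi (p : nat) (X Y : {group gT}) :
    X <| R -> Y <| A -> p.-group X -> p.-group Y -> p.-group P ->
    X \subset 'C(P) ->
    (forall w, w \in P -> exists x y, [/\ x \in X, y \in Y & beta x y = w]) ->
  'ker pairing_left :&: 'ker pairing_right \subset 'Phi(pairing_group).
Proof.
move=> nsXR nsYA pX pY pP cXP betaXY.
pose K : {group E} := (pairing_left @*^-1 X :&: pairing_right @*^-1 Y)%G.
have sET (f : {morphism pairing_group >-> gT}) (H : {group gT}) :
  f @* pairing_group = H ->
    pairing_group \subset f @*^-1 H by move <-; rewrite -sub_morphim_pre.
have nsKE : K <| pairing_group.
  rewrite /normal subsetT normsI //.
    apply: subset_trans (morphpre_norms _ (normal_norm nsXR)).
    exact: sET morphim_pairing_left.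
  apply: subset_trans (morphpre_norms _ (normal_norm nsYA)).
  exact: sET morphim_pairing_right.
have pK : p.-group K.
  have defK : val @: K = setX (setX X Y) P.
    apply/setP=> [[[x y] w]]; rewrite !inE /=; apply/imsetP/idP=> [[u] | ].
      rewrite !inE /= /pairing_left /pairing_right => Ku /esym Du.
      by have [_ _] := pairing_extP u; move: Ku; rewrite [Eval u]Du /= => ->.
    case/andP=> /andP[Xx Yy] Pw.
    have [Rx Ay] :=
      (subsetP (normal_sub nsXR) x Xx, subsetP (normal_sub nsYA) y Yy).
    have [u Du] := pairing_ext_exists Rx Ay Pw; exists u => //.
    by rewrite !inE /= /pairing_left /pairing_right Du Xx.
  rewrite /pgroup -(card_imset K val_inj) defK !cardsX !pnatM.
  by rewrite [_.-nat #|X|]pX [_.-nat #|Y|]pY.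
apply: subset_trans _ (Phi_normalS nsKE).
rewrite (Phi_joing pK) (subset_trans _ (joing_subl _ _)) //.
apply/subsetP=> n; rewrite !inE /= /pairing_left /pairing_right => Kn.
have [_ _ Pn] := pairing_extP n.
have [x [y [Xx Yy Dn]]] := betaXY _ Pn.
have [Rx Ay] :=
  (subsetP (normal_sub nsXR) x Xx, subsetP (normal_sub nsYA) y Yy).
have [u Du] := pairing_ext_exists Rx (group1 A) (group1 P).
have [v Dv] := pairing_ext_exists (group1 R) Ay (group1 P).
have -> : n = [~ u, v].
  apply: (mulgI (v * u)); rewrite -commgC; apply: val_inj.
  have [/eqP n1 /eqP n2] := andP Kn.
  rewrite /= Du Dv /= n1 n2 !mul1g !pairing1r // !conj1g !mulg1 conj1g mul1g.
  rewrite Dn conjgE.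
  by rewrite mul1g -(centsP cXP x^-1 _ n.2) ?groupV // mulKg.
apply: mem_commg; rewrite !inE /= /pairing_left /pairing_right ?Du ?Dv /=.
  by rewrite Xx group1.
by rewrite Yy group1.
Qed.

End PairingExtension.

(** * The pairing of a module with a power action *)

(** The exponents at two independent elements [x] and [y] agree because both
    agree with the exponent at [x * y]. *)
Lemma uniform_power_action (gT : finGroupType) (p : nat) (S : {group gT})
    (d : gT) :
    p.-abelem S -> (forall x, x \in S -> x ^ d \in <[x]>) ->
  exists e, forall x, x \in S -> x ^ d = x ^+ e.
Proof.
move=> abelS Sd; have [S1 | ntS] := eqVneq S 1%G.
  by exists 0%N => x; rewrite S1 => /set1P->; rewrite conj1g.
have [p_pr _ _] := pgroup_pdiv (abelem_pgroup abelS) ntS.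
have cSS := centsP (abelem_abelian abelS).
have [x Sx ntx] := trivgPn _ ntS.
have ox := abelem_order_p abelS Sx ntx.
have /cycleP[e De] := Sd x Sx; exists e => y Sy.
have [/cycleP[i ->] | notXy] := boolP (y \in <[x]>).
  by rewrite conjXg De -!expgM mulnC.
have oy : #[y] = p.
  apply: abelem_order_p abelS Sy _.
  by apply: contraNneq notXy => ->; rewrite group1.
have tiXY : <[x]> :&: <[y]> = 1.
  rewrite setIC prime_TIg -?orderE ?oy // cycle_subG.
  exact: notXy.
have /cycleP[f Df] := Sd y Sy.
have /cycleP[g Dg] := Sd (x * y) (groupM Sx Sy).
move: Dg; rewrite conjMg De Df expgMn; last exact: cSS.
move=> Dg; have Exy : (x ^+ g)^-1 * x ^+ e = y ^+ g * (y ^+ f)^-1.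
  apply: (mulgI (x ^+ g)); apply: (mulIg (y ^+ f)).
  by rewrite mulKVg Dg !mulgA mulgKV.
have : (x ^+ g)^-1 * x ^+ e \in <[x]> :&: <[y]>.
  by rewrite inE {2}Exy !groupM ?groupV ?mem_cycle.
rewrite tiXY => /set1P Ex; move: Exy; rewrite Ex => Ey.
have /eqP : x ^+ e = x ^+ g by apply: (mulgI (x ^+ g)^-1); rewrite mulVg Ex.
have /eqP : y ^+ g = y ^+ f by apply: (mulIg (y ^+ f)^-1); rewrite mulgV -Ey.
rewrite !eq_expg_mod_order ox oy => /eqP Efg /eqP Eeg.
by apply/eqP; rewrite eq_expg_mod_order oy Eeg Efg.
Qed.

Section CyclicLog.

Variables (gT : finGroupType) (x0 : gT).

Definition cyclic_log (x : gT) : nat :=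
  odflt ord0 [pick i : 'I_#[x0].+1 | x0 ^+ i == x].

Lemma cyclic_logK x : x \in <[x0]> -> x0 ^+ cyclic_log x = x.
Proof.
case/cyclePmin=> i lti ->; rewrite /cyclic_log; case: pickP => [j /eqP //|].
by move/(_ (Ordinal (leqW lti))); rewrite eqxx.
Qed.

(** The exponent of [v] may be chosen freely modulo the order of [x0], which is
    what makes [v ^+ cyclic_log x0 x] bilinear in [x] and [v]. *)
Lemma expg_cyclic_log (v : gT) n :
  #[v] %| #[x0] -> v ^+ cyclic_log (x0 ^+ n) = v ^+ n.
Proof.
move=> dv; apply/eqP; rewrite eq_expg_mod_order.
rewrite -(modn_dvdm _ dv) -(modn_dvdm n dv).
suff /eqP-> : cyclic_log (x0 ^+ n) == n %[mod #[x0]] by [].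
by rewrite -eq_expg_mod_order cyclic_logK // mem_cycle.
Qed.

End CyclicLog.

Section TwistedPairing.

Variables (gT : finGroupType) (p : nat) (S M A D : {group gT}) (x0 : gT).
Hypotheses (abelS : p.-abelem S) (Sx0 : x0 \in S) (ntx0 : x0 != 1).
Hypotheses (nSM : M \subset 'N(S)) (tiMS : M :&: S = 1) (defA : M * S = A).
Hypothesis powD : forall d, d \in D ->
  exists e, forall x, x \in S -> x ^ d = x ^+ e.
Hypothesis tiSD : S :&: D = 1.

(** The group of the top left blocks: the entry [l] of the matrix is the
    exponent of [x0], and the entry [d] is the scalar by which conjugation by
    the inverse of an element of [D] acts on [S]. *)
Definition twist_left : {group gT} := (<[x0]> <*> D)%G.

(** With [r = x0 ^+ l * d] and [a = m * v], this is the product [l v] of the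
    matrix entries, written multiplicatively. *)
Definition twist_fun r a := remgr M S a ^+ cyclic_log x0 (divgr <[x0]> D r).

Let cSS := centsP (abelem_abelian abelS).
Let sXS : <[x0]> \subset S. Proof. by rewrite cycle_subG. Qed.

Let nXD : D \subset 'N(<[x0]>).
Proof.
apply/subsetP=> d Dd; have [e De] := powD Dd.
by rewrite inE -genJ gen_subG conjg_set1 De // sub1set mem_cycle.
Qed.

Lemma twist_leftE : twist_left = <[x0]> * D :> {set gT}.
Proof. exact: norm_joinEr. Qed.

Let cXS x v : x \in <[x0]> -> v \in S -> v ^ x = v.
Proof.
move=> Xx Sv; rewrite conjgE -(cSS (subsetP sXS x Xx) Sv).
by rewrite mulKg.
Qed.

Lemma twist_left_power r : r \in twist_left ->
  exists e, forall x, x \in S -> x ^ r = x ^+ e.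
Proof.
rewrite twist_leftE => /mulsgP[x d Xx Dd ->]; have [e De] := powD Dd.
by exists e => y Sy; rewrite conjgM (cXS Xx Sy) De.
Qed.

Let nSR : twist_left \subset 'N(S).
Proof.
apply/subsetP=> r /twist_left_power[e De]; rewrite inE.
by apply/subsetP=> _ /imsetP[x Sx ->]; rewrite De // groupX.
Qed.

Let nSA : A \subset 'N(S).
Proof. by rewrite -defA mul_subG ?normG. Qed.

Let tiXD : <[x0]> :&: D = 1.
Proof. by apply/trivgP; rewrite -tiSD setSI. Qed.

Let ordS v : v \in S -> #[v] %| #[x0].
Proof.
move=> Sv; have [-> | ntv] := eqVneq v 1; first by rewrite order1 dvd1n.
by rewrite (abelem_order_p abelS Sv) ?(abelem_order_p abelS Sx0).
Qed.

Lemma twist_funE i d m v : d \in D -> m \in M -> v \in S ->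
  twist_fun (x0 ^+ i * d) (m * v) = v ^+ i.
Proof.
move=> Dd Mm Sv; rewrite /twist_fun remgrMid // divgrMid ?mem_cycle //.
exact: expg_cyclic_log (ordS Sv).
Qed.

Lemma twist_actC r a w : r \in twist_left -> a \in A -> w \in S ->
  (w ^ r) ^ a = (w ^ a) ^ r.
Proof.
move=> Rr Aa Sw; have [e De] := twist_left_power Rr.
by rewrite !De ?conjXg // memJ_norm // (subsetP nSA).
Qed.

Lemma twist_closed r a : r \in twist_left -> a \in A -> twist_fun r a \in S.
Proof. by move=> _ Aa; rewrite groupX // mem_remgr // defA. Qed.

Lemma twist_Ml r s a : r \in twist_left -> s \in twist_left -> a \in A ->
  twist_fun (r * s) a = twist_fun r a * twist_fun s a ^ r^-1.
Proof.
rewrite twist_leftE -defA => /mulsgP[_ d /cycleP[i ->] Dd ->].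
case/mulsgP=> _ e /cycleP[j ->] De -> /mulsgP[m v Mm Sv ->].
have [f Df] := powD (groupVr Dd).
have -> : x0 ^+ i * d * (x0 ^+ j * e) = x0 ^+ (i + j * f) * (d * e).
  rewrite expgD mulnC expgM -Df // -conjXg conjgE invgK -!mulgA.
  by rewrite mulKg.
rewrite !twist_funE ?groupM // expgD; congr (_ * _).
rewrite invMg conjgM Df ?groupX // cXS ?groupX //; last first.
  by rewrite groupV mem_cycle.
by rewrite expgM.
Qed.

Lemma twist_Mr r a b : r \in twist_left -> a \in A -> b \in A ->
  twist_fun r (a * b) = twist_fun r a ^ b * twist_fun r b.
Proof.
rewrite twist_leftE -defA => /mulsgP[_ d /cycleP[i ->] Dd ->].
case/mulsgP=> m v Mm Sv -> /mulsgP[n w Mn Sw ->].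
have Svn : v ^ n \in S by rewrite memJ_norm // (subsetP nSM).
have -> : m * v * (n * w) = m * n * (v ^ n * w) by rewrite conjgE !mulgA mulgK.
rewrite (twist_funE _ Dd (groupM Mm Mn) (groupM Svn Sw)) !twist_funE //.
rewrite expgMn; last exact: cSS.
congr (_ * _); rewrite conjXg conjgM [(v ^ n) ^ w]conjgE.
by rewrite -(cSS Sw Svn) mulKg.
Qed.

Definition twist_pairing : pairing twist_left A S :=
  Pairing (abelem_abelian abelS) nSR nSA twist_actC twist_closed
    twist_Ml twist_Mr.

End TwistedPairing.

(** * Enlarging a group by power automorphisms *)

(** Adjoining to [A = M S] a group [D] of scalars on [S] that commutes with [M]
    does not lead out of [F].  The extension [E] by the pairing of [<[x0]> D]
    and [A] lies in [F], and its subgroup [H] of the triples [(d, m, w)] with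
    [d] in [D] and [m] in [M] maps onto [G] by [m * w * d]. *)
Lemma formation_power_twist (F : group_class) (gT : finGroupType) (p : nat)
    (G S M A D : {group gT}) :
    formation F -> saturated F -> subgroup_closed F ->
    class_sub supersoluble F ->
    p.-abelem S -> S :!=: 1 -> M \subset 'N(S) ->
    M :&: S = 1 -> M * S = A -> A * D = G -> S :&: D = 1 ->
    abelian D -> D \subset 'C(M) ->
    (forall d, d \in D -> exists e, forall x, x \in S -> x ^ d = x ^+ e) ->
  F _ A -> F _ G.
Proof.
move=> Fform Fsat Fsub sUF abelS ntS nSM tiMS defA defG tiSD cDD cMD powD FA.
have [x0 Sx0 ntx0] := trivgPn _ ntS.
pose R := twist_left D x0.
pose beta := twist_pairing abelS Sx0 ntx0 nSM tiMS defA powD tiSD.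
pose E := pairing_group beta.
have sXS : <[x0]> \subset S by rewrite cycle_subG.
have abelX : p.-abelem <[x0]> := abelemS sXS abelS.
have nxR x : x \in S -> R \subset 'N(<[x]>).
  move=> Sx; apply/subsetP=> r /(twist_left_power abelS Sx0 powD)[e De].
  by rewrite inE -genJ gen_subG conjg_set1 De // sub1set mem_cycle.
have defR : R = <[x0]> * D :> {set gT} := twist_leftE Sx0 powD.
have nsXR : <[x0]> <| R by rewrite /normal defR mulG_subl -defR nxR.
have FR : F gT R.
  apply: sUF; apply: (supersoluble_power_action abelX nsXR) => [x Xx | ].
    rewrite /normal (subset_trans _ (normal_sub nsXR)) ?cycle_subG //.
    by rewrite nxR ?(subsetP sXS).
  by rewrite defR quotientMidl quotient_abelian.
have FE : F _ E.
  apply: (saturated_subdirect Fform Fsat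
    (f1 := [morphism of pairing_left (beta := beta)])
    (f2 := [morphism of pairing_right (beta := beta)])).
  - apply: (pairing_ext_Phi (p := p) nsXR (Y := S)).
    + by rewrite -defA /normal mulG_subr mul_subG ?normG.
    + exact: abelem_pgroup abelX.
    + exact: abelem_pgroup abelS.
    + exact: abelem_pgroup abelS.
    + exact: subset_trans sXS (abelem_abelian abelS).
    move=> w Sw; exists x0, w; split; rewrite ?cycle_id //=.
    have := twist_funE abelS Sx0 ntx0 tiMS tiSD 1 (group1 D) (group1 M) Sw.
    by rewrite !expg1 mulg1 mul1g.
  - by rewrite (_ : (_ @* _)%G = R) //; apply/group_inj/morphim_pairing_left.
  by rewrite (_ : (_ @* _)%G = A) //; apply/group_inj/morphim_pairing_right.
pose H : {group pairing_ext beta} :=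
  (pairing_left (beta := beta) @*^-1 D
    :&: pairing_right (beta := beta) @*^-1 M)%G.
have FH : F _ H by apply: Fsub FE; apply: subsetT.
pose f (u : pairing_ext beta) := u.1.2 * u.2 * u.1.1.
have fM : {in H &, {morph f : u v / u * v}}.
  move=> u v; rewrite !inE /= /pairing_left /pairing_right.
  case/andP=> Dd Mm /andP[Dd' Mm']; have [_ _ Sw'] := pairing_extP v.
  rewrite /f /= /twist_fun remgr1 // expg1n mul1g.
  case: u v Dd Mm Dd' Mm' Sw' => [[[d m] w] hu] [[[d' m'] w'] hv] /=.
  move=> Dd Mm Dd' Mm' Sw'; rewrite [w ^ m']conjgE [w' ^ d^-1]conjgE invgK.
  by rewrite -!mulgA mulKVg mulKg (mulgA m') -(centsP cMD d) ?mulgA.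
rewrite (_ : G = (Morphism fM @* H)%G); first exact: formation_morphim.
apply/group_inj/setP=> g; apply/idP/morphimP=> /= [|[u _]].
  rewrite -defG -defA => /mulsgP[_ d /mulsgP[m w Mm Sw ->] Dd ->].
  have Rd : d \in R by rewrite defR (subsetP (mulG_subr _ _)).
  have Am : m \in A by rewrite -defA (subsetP (mulG_subl _ _)).
  have [u Du] := pairing_ext_exists beta Rd Am Sw.
  have Hu : u \in H by rewrite !inE /= /pairing_left /pairing_right Du Dd.
  by exists u; rewrite // /f Du.
rewrite !inE /= /pairing_left /pairing_right => /andP[Dd Mm] ->.
have [_ Aa Sw] := pairing_extP u.
by rewrite -defG mem_mulg // groupM // -defA (subsetP (mulG_subr _ _)).
Qed.

(** * Permuting subgroups of coprime prime power order *)

Lemma pgroup_coprime_neq (gT : finGroupType) (p q : nat) (P Q : {group gT}) :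
  p != q -> p.-group P -> q.-group Q -> coprime #|P| #|Q|.
Proof.
move=> neq_pq pP qQ; apply: pnat_coprime pP _.
by apply: sub_in_pnat qQ => r _ /eqP->; rewrite !inE eq_sym.
Qed.

(** By induction, a maximal subgroup [V] of [Q] normalises [P], so the number of
    Sylow [p]-subgroups of [P Q] divides the index [q] of [P V].  It is also
    [1] modulo [p], and [q < p], so it is [1]. *)
Lemma pgroup_permuting_norm (gT : finGroupType) (p q : nat) (P Q : {group gT}) :
    prime p -> prime q -> q < p -> p.-group P -> q.-group Q ->
    (forall V : {group gT}, V \subset Q -> P * V = V * P) ->
  Q \subset 'N(P).
Proof.
move=> p_pr q_pr lt_qp pP; have [n] := ubnP #|Q|.
elim: n Q => // n IHn Q /ltnSE-leQn qQ permPQ.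
have [<- | [V maxV _]] := maximal_exists (sub1G Q); first exact: sub1G.
have [/andP[sVQ not_sQV] _] := maxgroupP maxV.
have nPV : V \subset 'N(P).
  apply: IHn (pgroupS sVQ qQ) _ => [|U sUV].
    by rewrite (leq_trans _ leQn) // proper_card // /proper sVQ.
  by rewrite permPQ // (subset_trans sUV).
have neq_pq : p != q by rewrite neq_ltn lt_qp orbT.
have coPQ := pgroup_coprime_neq neq_pq pP qQ.
pose H := (P <*> Q)%G.
have defH : P * Q = H by rewrite -comm_joingE //; apply: permPQ.
have defPV : P <*> V = P * V by rewrite norm_joinEr.
have oH : #|H| = (#|P| * #|Q|)%N by rewrite -defH coprime_cardMg.
have sPH : P \subset H by rewrite joing_subl.
have sylP : p.-Sylow(H) P.
  rewrite /pHall sPH pP -divgS // oH mulKn //.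
  by apply: sub_in_pnat qQ => r _ /eqP->; rewrite !inE eq_sym.
have dvd_q : #|'Syl_p(H)| %| q.
  rewrite (card_Syl sylP) -(p_maximal_index qQ maxV).
  have sPVN : P <*> V \subset 'N_H(P).
    rewrite subsetI join_subG sPH join_subG normG nPV.
    by rewrite (subset_trans sVQ) ?joing_subr.
  have -> : #|Q : V| = #|H : P <*> V|.
    have sPVH : P <*> V \subset H by rewrite genS // setUS.
    rewrite -!divgS //= oH defPV coprime_cardMg ?divnMl //.
    exact: coprimegS sVQ coPQ.
  by rewrite -(Lagrange_index (subsetIl _ _) sPVN) dvdn_mulr.
have syl1 : #|'Syl_p(H)| = 1%N.
  have := card_Syl_mod H p_pr; case/primeP: (q_pr) => _ /(_ _ dvd_q).
  by case/pred2P=> -> //; rewrite modn_small.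
have : #|H : 'N_H(P)| == 1%N by rewrite -(card_Syl sylP) syl1.
rewrite indexg_eq1 subsetI subxx /=; apply: subset_trans.
exact: joing_subr.
Qed.

(** Mutual permutability passes to arbitrary subgroups [U] and [V]: as [P] and
    [Q] have coprime orders, [U V] is the intersection of the groups [U Q] and
    [P V].  So the previous lemma applies to [U] in place of [P]. *)
Lemma mutually_permutable_norm (gT : finGroupType) (p q : nat)
    (P Q U : {group gT}) :
    prime p -> prime q -> q < p -> p.-group P -> q.-group Q ->
    mutually_permutable P Q -> U \subset P ->
  Q \subset 'N(U).
Proof.
move=> p_pr q_pr lt_qp pP qQ [permP permQ] sUP.
apply: (pgroup_permuting_norm p_pr q_pr lt_qp (pgroupS sUP pP) qQ) => V sVQ.
have neq_pq : p != q by rewrite neq_ltn lt_qp orbT.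
have tiPQ : P :&: Q = 1 := coprime_TIg (pgroup_coprime_neq neq_pq pP qQ).
apply/comm_group_setP.
(* If [u * z = x * v], then [x^-1 * u = v * z^-1] lies in both [P] and [Q],
   which meet trivially. *)
have -> : U * V = (U * Q) :&: (P * V).
  apply/eqP; rewrite eqEsubset subsetI mulgS //= mulSg //=.
  apply/subsetP=> _ /setIP[/mulsgP[u z Uu Qz ->]].
  case/mulsgP=> x v Px Vv Euz.
  have Exu : x^-1 * u = v * z^-1.
    by apply: (mulgI x); apply: (mulIg z); rewrite mulKVg Euz !mulgA mulgKV.
  have /set1P xu1 : x^-1 * u \in [1 gT].
    rewrite -tiPQ inE {2}Exu !groupM ?groupV ?(subsetP sUP u) //.
    exact: subsetP sVQ v Vv.
  have -> : z = v by apply: (mulIg z^-1); rewrite mulgV -Exu.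
  exact: mem_mulg.
have gUQ : group_set (U * Q) by apply/comm_group_setP/permP.
have gPV : group_set (P * V) by apply/comm_group_setP/permQ.
exact: group_setI (Group gUQ) (Group gPV).
Qed.

(** * Sylow subgroups of products *)

Lemma sub_group_Sylow (gT : finGroupType) (A H : {group gT}) :
    (forall (q : nat) (Q : {group gT}),
      prime q -> q.-Sylow(A) Q -> Q \subset H) ->
  A \subset H.
Proof.
move=> sylH; rewrite -(Sylow_gen A) gen_subG; apply/bigcupsP=> Q.
by case/SylowP=> q q_pr sylQ; apply: sylH sylQ.
Qed.

(** A Sylow subgroup of [G] containing [P] has a conjugate that contains [Q].
    The conjugating element factors as [a * b], and [P] and [Q] are invariant
    under [a] and [b], so one Sylow subgroup contains both.  Comparing orders,
    it is their product. *)
Lemma Sylow_mul_normal (gT : finGroupType) (p : nat) (G A B P Q : {group gT}) :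
    A * B = G -> p.-Sylow(A) P -> P <| A -> p.-Sylow(B) Q -> Q <| B ->
  exists2 S : {group gT}, p.-Sylow(G) S & P * Q = S.
Proof.
move=> defG sylP nsPA sylQ nsQB; have [sAG sBG] := mulG_sub defG.
have [T sylT sPT] := Sylow_superset
  (subset_trans (normal_sub nsPA) sAG) (pHall_pgroup sylP).
have [g Gg] := Sylow_subJ sylT
  (subset_trans (normal_sub nsQB) sBG) (pHall_pgroup sylQ).
move: Gg; rewrite -{1}defG => /mulsgP[a b Aa Bb ->]; rewrite conjsgM => sQT.
pose S := (T :^ a)%G; have sylS : p.-Sylow(G) S.
  by rewrite pHallJ // (subsetP sAG).
have sPS : P \subset S by rewrite -(normsP (normal_norm nsPA) a Aa) conjSg.
have sQS : Q \subset S.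
  by rewrite -(conjSg _ _ b) (normsP (normal_norm nsQB) b Bb).
exists S => //; apply/eqP; rewrite eqEcard mul_subG //=.
rewrite -(leq_pmul2r (cardG_gt0 (P :&: Q))) -mul_cardG.
rewrite (card_Hall sylP) (card_Hall sylQ) (card_Hall sylS).
rewrite -partnM ?cardG_gt0 // mul_cardG defG partnM ?cardG_gt0 //.
rewrite leq_pmul2l ?part_gt0 //.
have sPQ : P :&: Q \subset A :&: B.
  by rewrite setISS ?(pHall_sub sylP) ?(pHall_sub sylQ).
rewrite -(part_pnat_id (pgroupS (subsetIl _ _) (pHall_pgroup sylP))) /=.
by rewrite dvdn_leq ?part_gt0 // partn_dvd ?cardSg.
Qed.

Lemma tower_normal_Sylow (gT : finGroupType) (p : nat) (A : {group gT}) :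
    sylow_tower_supersoluble_type A -> prime p ->
    (forall q, prime q -> q %| #|A| -> q <= p) ->
  exists2 P : {group gT}, P <| A & p.-Sylow(A) P.
Proof.
move=> towerA p_pr max_p; have [pA | p'A] := boolP (p %| #|A|); last first.
  exists 1%G; first exact: normal1.
  by rewrite pHallE sub1G cards1 part_p'nat // p'natE.
have : p \in primes #|A| by rewrite mem_primes p_pr cardG_gt0.
move: (towerA 1%N) (sorted_primes #|A|).
have: {subset primes #|A| <= [pred q | q <= p]}.
  by move=> q; rewrite mem_primes => /and3P[q_pr _ /(max_p q q_pr)].
case/lastP: (primes #|A|) => // s q max_s; rewrite rev_rcons /=.
have le_qp : q <= p by apply: max_s; rewrite mem_rcons mem_head.
case=> // N nsNA oN.
rewrite (sorted_pairwise ltn_trans) pairwise_rcons mem_rcons inE.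
case/andP=> lt_s _.
case/predU1P=> [Dp | /(allP lt_s)/=]; last by rewrite ltnNge le_qp.
exists N => //; rewrite pHallE normal_sub //= oN take0 big_seq1.
by rewrite p_part Dp.
Qed.

(** * Products of msp-permutable subgroups *)

Lemma mutually_permutable_sym (gT : finGroupType) (X Y : {group gT}) :
  mutually_permutable X Y -> mutually_permutable Y X.
Proof. by case=> permX permY; split=> U sU; rewrite (permX, permY). Qed.

Lemma msp_permutable_sym (gT : finGroupType) (A B : {group gT}) :
  msp_permutable A B -> msp_permutable B A.
Proof.
case=> /comm_group_setP cAB mspAB; split; first by apply/comm_group_setP.
move=> p q P Q p_pr q_pr neq_pq sylP sylQ; apply: mutually_permutable_sym.
by apply: mspAB sylQ sylP; rewrite // eq_sym.
Qed.

(** Subgroups of the image of a subgroup lift to it, and permutability is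
    preserved by homomorphisms. *)
Lemma mutually_permutable_quotient (gT : finGroupType) (X Y N : {group gT}) :
    X \subset 'N(N) -> Y \subset 'N(N) -> mutually_permutable X Y ->
  mutually_permutable (X / N)%G (Y / N)%G.
Proof.
have lift (Z : {group gT}) (U : {group coset_of N}) : U \subset Z / N ->
    exists2 V : {group gT}, V \subset Z & U :=: V / N.
  move=> sUZ; exists (Z :&: coset N @*^-1 U)%G; first exact: subsetIl.
  by rewrite quotientIG ?sub_cosetpre //= cosetpreK (setIidPr sUZ).
move=> nNX nNY [permX permY]; split=> U /lift[V sV ->].
  by rewrite -!quotientMl ?permX ?quotientMr // (subset_trans sV).
by rewrite -!quotientMl ?permY // (subset_trans sV).
Qed.

(** Sylow subgroups map to Sylow subgroups, and these are conjugate by elements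
    that lift. *)
Lemma quotient_Sylow_lift (gT : finGroupType) (p : nat) (A N : {group gT})
    (Q : {group coset_of N}) :
    A \subset 'N(N) -> p.-Sylow(A / N) Q ->
  exists2 P : {group gT}, p.-Sylow(A) P & Q :=: P / N.
Proof.
move=> nNA sylQ; have [P sylP] := Sylow_exists p A.
have nNP := subset_trans (pHall_sub sylP) nNA.
have [_ /morphimP[a Na Aa ->] ->] := Sylow_trans (quotient_pHall nNP sylP) sylQ.
by exists (P :^ a)%G; rewrite ?pHallJ // -quotientJ.
Qed.

Lemma msp_permutable_quotient (gT : finGroupType) (A B N : {group gT}) :
    A \subset 'N(N) -> B \subset 'N(N) -> msp_permutable A B ->
  msp_permutable (A / N)%G (B / N)%G.
Proof.
move=> nNA nNB [/comm_group_setP cAB mspAB]; split.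
  by apply/comm_group_setP; rewrite /commute -!quotientMl ?cAB.
move=> p q P Q p_pr q_pr neq_pq.
case/(quotient_Sylow_lift nNA)=> P0 sylP0 defP.
case/(quotient_Sylow_lift nNB)=> Q0 sylQ0 defQ.
rewrite (group_inj defP : P = (P0 / N)%G) (group_inj defQ : Q = (Q0 / N)%G).
apply: mutually_permutable_quotient; last exact: mspAB sylP0 sylQ0.
  exact: subset_trans (pHall_sub sylP0) nNA.
exact: subset_trans (pHall_sub sylQ0) nNB.
Qed.

(** A prime [q] that does not divide the order of [B] may exceed [p], but then
    [R] is trivial. *)
Lemma msp_Sylow_norm (gT : finGroupType) (p q : nat) (A B P U R : {group gT}) :
    msp_permutable A B -> prime p -> prime q -> p != q ->
    (forall r, prime r -> r %| #|B| -> r <= p) ->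
    p.-Sylow(A) P -> U \subset P -> q.-Sylow(B) R ->
  R \subset 'N(U).
Proof.
move=> [_ mspAB] p_pr q_pr neq_pq max_p sylP sUP sylR.
have [qB | q'B] := boolP (q %| #|B|); last first.
  have /eqP : #|R| = 1%N.
    by rewrite (card_Hall sylR) part_p'nat // p'natE.
  by rewrite -trivg_card1 => /eqP->; apply: sub1G.
have lt_qp : q < p by rewrite ltn_neqAle eq_sym neq_pq max_p.
have mpPR := mspAB _ _ _ _ p_pr q_pr neq_pq sylP sylR.
apply: (mutually_permutable_norm p_pr q_pr lt_qp) mpPR sUP.
  exact: pHall_pgroup sylP.
exact: pHall_pgroup sylR.
Qed.

(** It is enough to consider Sylow subgroups of [A].  Those for the prime [p]
    lie in [P]; the others normalise [P], which is normal in [A], and also [Q],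
    by mutual permutability. *)
Lemma msp_norm_Sylow_mul (gT : finGroupType) (p : nat)
    (A B P Q S : {group gT}) :
    msp_permutable A B -> prime p ->
    (forall r, prime r -> r %| #|A| -> r <= p) ->
    P <| A -> p.-Sylow(A) P -> p.-Sylow(B) Q -> P * Q = S ->
  A \subset 'N(S).
Proof.
move=> mspAB p_pr max_p nsPA sylP sylQ defS.
apply: sub_group_Sylow => q R q_pr sylR; have [Dq | neq_pq] := eqVneq p q.
  rewrite -Dq in sylR; apply: subset_trans (normG S).
  have sRP : R \subset P.
    rewrite (sub_normal_Hall sylP nsPA) ?(pHall_sub sylR) //.
    exact: pHall_pgroup sylR.
  by rewrite (subset_trans sRP) // -defS mulG_subl.
rewrite -defS normsM //.
  exact: subset_trans (pHall_sub sylR) (normal_norm nsPA).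
have mspBA := msp_permutable_sym mspAB.
exact: msp_Sylow_norm mspBA p_pr q_pr neq_pq max_p sylQ (subxx Q) sylR.
Qed.

(** The Sylow [p]-subgroups of [B] centralise [P], both being in the abelian
    group [S]; the other Sylow subgroups of [B] normalise all subgroups of [P]
    by mutual permutability. *)
Lemma msp_normal_Sylow_factor (gT : finGroupType) (p : nat)
    (G A B P S : {group gT}) :
    A * B = G -> msp_permutable A B -> prime p ->
    (forall r, prime r -> r %| #|B| -> r <= p) ->
    P <| A -> p.-Sylow(A) P -> p.-Sylow(G) S -> S <| G -> abelian S ->
  (forall U : {group gT}, U \subset P -> B \subset 'N(U)) /\ P <| G.
Proof.
move=> defG mspAB p_pr max_p nsPA sylP sylS nsSG cSS.
have [sAG sBG] := mulG_sub defG.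
have sPS : P \subset S.
  rewrite (sub_normal_Hall sylS nsSG) ?(pHall_pgroup sylP) //.
  exact: subset_trans (pHall_sub sylP) sAG.
have nUB (U : {group gT}) : U \subset P -> B \subset 'N(U).
  move=> sUP; apply: sub_group_Sylow => q R q_pr sylR.
  have [Dq | neq_pq] := eqVneq p q; last first.
    exact: msp_Sylow_norm mspAB p_pr q_pr neq_pq max_p sylP sUP sylR.
  rewrite -Dq in sylR; apply: cents_norm.
  have sRS : R \subset S.
    rewrite (sub_normal_Hall sylS nsSG) ?(pHall_pgroup sylR) //.
    exact: subset_trans (pHall_sub sylR) sBG.
  exact: centSS sRS (subset_trans sUP sPS) cSS.
split=> //; rewrite /normal (subset_trans sPS (normal_sub nsSG)) /=.
by rewrite -defG mul_subG ?(normal_norm nsPA) ?nUB.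
Qed.

Section Main.

Variable F : group_class.
Hypotheses (Fformation : formation F) (Fsaturated : saturated F).
Hypotheses (Fsubgroup : subgroup_closed F).
Hypotheses (U_sub_F : class_sub supersoluble F).
Hypotheses (F_sub_D : class_sub F sylow_tower_supersoluble_type).

(** The product [S B] acts on [S] by scalars, and so does its intersection [D]
    with the complement [M].  Scalars commute with every automorphism of [S] and
    [M] acts faithfully on [S], so [D] is central in [M].  As [G = A D], it is
    obtained from [A] by adjoining the scalars in [D]. *)
Lemma formation_power_factor (gT : finGroupType) (p : nat)
    (G A B S M : {group gT}) :
    A * B = G -> p.-abelem S -> S :!=: 1 -> S <| G -> S \subset A ->
    S * M = G -> S :&: M = 1 -> 'C_M(S) = 1 ->
    (forall U : {group gT}, U \subset S -> B \subset 'N(U)) ->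
  F A -> F G.
Proof.
move=> defG abelS ntS nsSG sSA defSM tiSM tcM nUB FA.
have [[sAG sBG] [_ sMG]] := (mulG_sub defG, mulG_sub defSM).
have [sSG nSG] := andP nsSG; have cSS := abelem_abelian abelS.
have nSB := subset_trans sBG nSG; have nSM := subset_trans sMG nSG.
pose D := (M :&: (S <*> B))%G.
have powD d : d \in D -> exists e, forall x, x \in S -> x ^ d = x ^+ e.
  case/setIP=> _; rewrite /= norm_joinEr // => /mulsgP[s b Ss Bb ->].
  have [|e De] := uniform_power_action (d := b) abelS.
    move=> x Sx; have := subsetP (nUB <[x]>%G _) b Bb.
    by rewrite cycle_subG => /(_ Sx) nxb; rewrite memJ_norm // cycle_id.
  exists e => x Sx; rewrite conjgM -De //; congr (_ ^ b).
  by rewrite conjgE -(centsP cSS s Ss x Sx) mulKg.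
have cMD : D \subset 'C(M).
  apply/centsP=> d Dd m Mm; have [e De] := powD d Dd.
  have [Md _] := setIP Dd.
  (* Powers of the scalar [d] commute with conjugation by [m], so the commutator
     of [d] and [m] acts trivially on [S]. *)
  have /set1P : d * m * (m * d)^-1 \in [1 gT].
    rewrite -tcM inE (groupM (groupM Md Mm) (groupVr (groupM Mm Md))) /=.
    apply/centP=> x Sx.
    apply/esym/commgP/conjg_fixP; rewrite conjgM.
    have -> : x ^ (d * m) = x ^ (m * d).
      by rewrite !conjgM De // conjXg De // memJ_norm // (subsetP nSM).
    by rewrite conjgK.
  by move/eqP; rewrite -eq_mulgV1 => /eqP.
have defSD : S * D = S <*> B.
  by rewrite /= group_modl ?joing_subl // defSM (setIidPr _) // join_subG sSG.
have defAS : A * S = A by rewrite mulGSid.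
apply: (formation_power_twist (S := S) (M := (A :&: M)%G) (A := A) (D := D)
  Fformation Fsaturated Fsubgroup U_sub_F abelS ntS _ _ _ _ _ _ _ powD FA).
- by rewrite subIset ?nSM ?orbT.
- by rewrite /= -setIA (setIC M) tiSM setIg1.
- rewrite /= normC; last by rewrite subIset ?nSM ?orbT.
  by rewrite setIC group_modl // defSM; apply/setIidPr.
- by rewrite -defAS -mulgA defSD norm_joinEr // mulgA defAS.
- by apply/trivgP; rewrite -tiSM setIS // subsetIl.
- exact: subset_trans cMD (centS (subsetIl _ _)).
exact: subset_trans cMD (centS (subsetIr _ _)).
Qed.

(** The reduction to the primitive case: unless [G] is in [F], the Sylow
    [p]-subgroup [S] for the largest prime [p] is minimal normal, has a
    complement [M], a maximal subgroup avoiding a minimal normal subgroup, and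
    [M] acts faithfully on it. *)
Lemma msp_formation_of_quotients (gT : finGroupType) (G A B : {group gT}) :
    A * B = G -> msp_permutable A B -> F A -> F B ->
    (forall N : {group gT}, N <| G -> N :!=: 1 -> F (G / N)%G) ->
  F G.
Proof.
move=> defG mspAB FA FB FGN; have [sAG sBG] := mulG_sub defG.
have [G1 | ntG] := eqVneq G 1%G.
  rewrite (_ : G = A) //; apply/group_inj/eqP.
  by rewrite eqEsubset sAG G1 sub1G.
have [Phi1 | ntPhi] := eqVneq 'Phi(G) 1; last first.
  by apply/Fsaturated/FGN => //; apply: Phi_normal.
have trivial_meet (N1 N2 : {group gT}) : N1 <| G -> N2 <| G -> N1 :!=: 1 ->
    N2 :!=: 1 -> N1 :&: N2 = 1 -> F G.
  move=> ns1 ns2 nt1 nt2 ti12.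
  by apply: (formation_trivial_meet Fformation ns1 ns2 ti12); apply: FGN.
have G_gt1 : 1 < #|G| by rewrite cardG_gt1.
pose p := max_pdiv #|G|.
have p_pr : prime p := max_pdiv_prime G_gt1.
have max_p (H : {group gT}) r : H \subset G -> prime r -> r %| #|H| -> r <= p.
  move=> sHG r_pr rH; apply: max_pdiv_max.
  by rewrite mem_primes r_pr cardG_gt0 (dvdn_trans rH) ?cardSg.
have max_pA r := max_p A r sAG; have max_pB r := max_p B r sBG.
have [P nsPA sylP] := tower_normal_Sylow (F_sub_D FA) p_pr max_pA.
have [Q nsQB sylQ] := tower_normal_Sylow (F_sub_D FB) p_pr max_pB.
have [S sylS defS] := Sylow_mul_normal defG sylP nsPA sylQ nsQB.
have sSG := pHall_sub sylS; have pS := pHall_pgroup sylS.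
have cAB : A * B = B * A by apply/comm_group_setP; rewrite defG groupP.
have cPQ : Q * P = S.
  by rewrite -defS; apply/esym/comm_group_setP; rewrite defS groupP.
have nsSG : S <| G.
  rewrite /normal sSG -defG mul_subG //.
    exact: msp_norm_Sylow_mul mspAB p_pr max_pA nsPA sylP sylQ defS.
  have mspBA := msp_permutable_sym mspAB.
  exact: msp_norm_Sylow_mul mspBA p_pr max_pB nsQB sylQ sylP cPQ.
have ntS : S :!=: 1.
  by rewrite -cardG_gt1 (card_Hall sylS) p_part_gt1 pi_max_pdiv.
have abelS : p.-abelem S.
  by rewrite -trivg_Phi // -subG1 -Phi1 Phi_normalS.
have cSS := abelem_abelian abelS.
(* [S] turns out to be equal to [N], because otherwise [S :&: M] is a
   nontrivial normal subgroup that meets [N] trivially. *)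
have [N minN sNS] : {N : {group gT} | minnormal N G & N \subset S}.
  by apply: mingroup_exists; rewrite ntS normal_norm.
have [/andP[ntN nNG] minimalN] := mingroupP minN.
have nsNG : N <| G by rewrite /normal (subset_trans sNS).
have [M maxM not_sNM] : exists2 M : {group gT}, maximal M G & ~~ (N \subset M).
  apply: not_sub_Phi_maximal; first exact: normal_sub.
  by rewrite Phi1 subG1.
have defNM := mulg_normal_not_sub_maximal nsNG maxM not_sNM.
have [_ sMG] := mulG_sub defNM.
have nsSMG : S :&: M <| G.
  rewrite /normal subIset ?sSG //= -defNM mul_subG //.
    exact/cents_norm/(centSS sNS (subsetIl _ _) cSS).
  by rewrite normsI ?normG // (subset_trans sMG) // normal_norm.
have [tiSM | ntSM] := eqVneq (S :&: M) 1; last first.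
  apply: (trivial_meet N (S :&: M)%G) => //; apply/eqP.
  apply: contraNT not_sNM => ntNSM.
  rewrite -(minimalN (N :&: (S :&: M))%G) ?subsetIl //.
    by rewrite /= setIA subsetIr.
  by rewrite /= ntNSM normsI // normal_norm.
have defNS : N :=: S.
  by rewrite -(setIidPr sSG) -defNM -group_modl // setIC tiSM mulg1.
have defSM : S * M = G by rewrite -defNS.
have nsCG : 'C_M(S) <| G.
  rewrite /normal subIset ?sMG //= -defSM mul_subG //.
    by rewrite cents_norm // centsC subsetIr.
  by rewrite normsI ?normG // norms_cent // (subset_trans sMG) // normal_norm.
have [tcM | ntC] := eqVneq 'C_M(S) 1; last first.
  apply: (trivial_meet S 'C_M(S)%G) => //.
  by apply/trivgP; rewrite -tiSM setIS // subsetIl.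
have [nUB nsPG] :=
  msp_normal_Sylow_factor defG mspAB p_pr max_pB nsPA sylP sylS nsSG cSS.
(* By minimality of [S], if [P] is trivial then [Q = S], and the roles of [A]
   and [B] are exchanged. *)
have [P1 | ntP] := eqVneq P 1%G.
  have defQ : Q = S by apply/group_inj; rewrite -defS P1 mul1g.
  rewrite defQ in sylQ nsQB.
  have [nUA _] := msp_normal_Sylow_factor (etrans (esym cAB) defG)
    (msp_permutable_sym mspAB) p_pr max_pA nsQB sylQ sylS nsSG cSS.
  apply: (formation_power_factor (etrans (esym cAB) defG) abelS ntS nsSG _
    defSM tiSM tcM nUA FB); exact: normal_sub.
have defP : P = S.
  apply/group_inj; rewrite -defNS; apply: minimalN.
    by rewrite ntP normal_norm.
  by rewrite defNS -defS mulG_subl.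
rewrite defP in nUB nsPA.
exact: (formation_power_factor defG abelS ntS nsSG (normal_sub nsPA)
  defSM tiSM tcM nUB FA).
Qed.

End Main.

Theorem theorem3p1 (F : group_class)
    (Fformation : formation F)
    (Fsaturated : saturated F)
    (Fsubgroup : subgroup_closed F)
    (U_sub_F : class_sub supersoluble F)
    (F_sub_D : class_sub F sylow_tower_supersoluble_type)
    (gT : finGroupType) (G G1 G2 : {group gT})
    (defG : G1 * G2 = G)
    (mspG : msp_permutable G1 G2)
    (FG1 : F gT G1) (FG2 : F gT G2) :
  F gT G.
Proof.
have [n] := ubnP #|G|; elim: n => // n IHn in gT G G1 G2 defG mspG FG1 FG2 *.
move=> /ltnSE-leGn.
apply: (msp_formation_of_quotients Fformation Fsaturated Fsubgroup
  U_sub_F F_sub_D defG mspG FG1 FG2) => N nsNG ntN.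
have [[sG1 sG2] nNG] := (mulG_sub defG, normal_norm nsNG).
have nNG1 := subset_trans sG1 nNG; have nNG2 := subset_trans sG2 nNG.
have Fquotient (H : {group gT}) : H \subset 'N(N) -> F gT H -> F _ (H / N)%G.
  move=> nNH FH; have [Fisog Fquo _] := Fformation.
  have nsNH : (N :&: H)%G <| H by rewrite /= setIC norm_normalI.
  exact: Fisog (second_isog nNH) (Fquo _ _ _ nsNH FH).
apply: (IHn _ _ (G1 / N)%G (G2 / N)%G).
- by rewrite -quotientMl ?defG.
- exact: msp_permutable_quotient.
- exact: Fquotient.
- exact: Fquotient.
by rewrite (leq_trans _ leGn) // ltn_quotient // normal_sub.
Qed.
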